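(* Let $m,n\ge 2$. If $C$ is any maximal configuration on the $m\times n$ grid, then $$|C|\ge I_{m,n}\ge\begin{cases}\frac{mn}{2}+2, & \text{if } n\equiv 0 \pmod 4,\\ \frac{m(n+2)}{2}, & \text{if } n\equiv 2\pmod 4,\\ \frac{m(n+1)}{2}+1, & \text{if } n\equiv 1\pmod 2.\end{cases}$$
   Context: The $m\times n$ grid is $[m]\times[n]=\{(i,j):1\le i\le m,\ 1\le j\le n\}$; $(i,j)$ is the lot in row $i$ and column $j$, rows counted from the north (row $m$ southernmost) and columns from the west. A configuration is a subset $C\subseteq[m]\times[n]$ (the occupied lots); $|C|$ is its occupancy. A house at $(i,j)\in C$ is blocked from sunlight if $(i,j+1)$, $(i,j-1)$, $(i+1,j)$ all lie in the grid and are all occupied (lots outside the grid never obstruct sunlight). A configuration is permissible if no house in it is blocked; it is maximal if it is permissible and no permissible configuration strictly contains it. $I_{m,n}$ denotes the minimum of $|C|$ over all maximal configurations $C$ on the $m\times n$ grid. *)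

(* Defs.v *)
From mathcomp Require Import all_boot.

Set Implicit Arguments.
Unset Strict Implicit.
Unset Printing Implicit Defensive.

(* Lots are indexed from 0: ((i, j) : 'I_m * 'I_n) is the lot in row i.+1,
   column j.+1. Rows grow southwards, columns grow eastwards. *)
Definition config (m n : nat) := {set 'I_m * 'I_n}.

(* The witnesses e, w, s are lots of the grid, so a house on the east, west or
   south border is never blocked. *)
Definition blocked (m n : nat) (C : config m n) (x : 'I_m * 'I_n) : bool :=
  [&& x \in C,
      [exists e in C, (e.1 == x.1) && (e.2 == x.2.+1 :> nat)],
      [exists w in C, (w.1 == x.1) && (w.2.+1 == x.2 :> nat)] &
      [exists s in C, (s.1 == x.1.+1 :> nat) && (s.2 == x.2)]].

Definition permissible (m n : nat) (C : config m n) : bool :=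
  [forall x in C, ~~ blocked C x].

Definition maximal (m n : nat) (C : config m n) : bool :=
  maxset (@permissible m n) C.

Definition maximal_occupancy (m n k : nat) : bool :=
  [exists C : config m n, maximal C && (#|C| == k)].

Lemma ex_maximal_occupancy (m n : nat) : exists k, maximal_occupancy m n k.
Proof.
have perm0 : permissible (set0 : config m n).
  by apply/forall_inP => x; rewrite inE.
have [C maxC _] := maxset_exists perm0.
by exists #|C|; apply/existsP; exists C; rewrite eqxx andbT.
Qed.

Definition min_occupancy (m n : nat) : nat :=
  ex_minn (ex_maximal_occupancy m n).

(* Main.v *)
Require Import Defs.
From mathcomp Require Import all_boot all_order all_algebra zify.

(** Call an occupied lot a centre if both its horizontal neighbours are occupied.
    In a maximal configuration the lot south of a centre is empty, and every other
    empty lot is accounted for inside its own row: it has two occupied neighbours,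
    or a pair of adjacent houses on one side.  Charging each such lot to the
    adjacent runs of houses shows that, in every row, the houses that are not
    centres are at least as many as the empty lots that are not below a centre.
    As centres of row [i] and empty lots below them cancel, this telescopes to
    [2 |C| >= m n].

    For the sharp bound, cut each row at its blocks of centres and at its blocks
    of lots below centres.  A piece of a row has a positive excess of houses over
    empty lots as soon as one of its ends is "open": the end of a block of centres
    when the lot south of the flanking house is empty, or the end of a block below
    centres when the flanking lot is occupied.  The same lot decides both
    conditions, so each end of a block of centres is open in exactly one of the two
    rows that meet there.  Putting a weight [+w] on open ends, [-w] on closed ends
    and [+w] on the borders of the grid, the weights of the blocks cancel between
    consecutive rows and only the borders remain, unless the row is the periodic
    pattern [.XX..XX.], which forces [4 %| n].  The weight is [0] if [4 %| n], is
    carried by the even positions if [n = 2 %[mod 4]], and is constant if [n] is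
    odd.  The last two rows are counted by hand and contribute the additive term. *)

Set Implicit Arguments.
Unset Strict Implicit.
Unset Printing Implicit Defensive.

Import Order.TTheory GRing.Theory Num.Theory.

Local Open Scope ring_scope.

(* Throughout, rows are functions [nat -> bool] whose lots are numbered from 1;
   position [p] is the boundary between lots [p] and [p.+1]. *)
Definition triple (x : nat -> bool) (j : nat) : bool :=
  [&& x j.-1, x j & x j.+1].

Definition sgnb (b : bool) : int := if b then 1 else -1.

(* The signed weight at position [p] for the ends of the blocks of [t]: the sign is
   read off in the row [b] at the lot flanking the block. *)
Definition side (w : nat -> int) (t b : nat -> bool) (p : nat) : int :=
  w p * ((if t p.+1 && ~~ t p then sgnb (b p) else 0) +
         (if t p && ~~ t p.+1 then sgnb (b p.+1) else 0)).

(* [d] marks the lots below a centre of the row to the north; values are doubled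
   so that weights can be half-integers. *)
Definition excess (x d : nat -> bool) (j : nat) : int :=
  if x j then (if triple x j then 0 else 2) else (if d j then 0 else -2).

(* Building on the empty lot [j] blocks the new house itself, its west neighbour or
   its east neighbour; [s] is the row to the south. *)
Definition justified (x s : nat -> bool) (j : nat) : bool :=
  [|| [&& x j.-1, x j.+1 & s j], [&& x j.-1, x j.-2 & s j.-1]
    | [&& x j.+1, x j.+2 & s j.+1]].

(** Subtracting [2 * w 0] turns a term [w 0] of [level] into [- w 0]. *)
Definition phase_drop (w : nat -> int) (r j : nat) : int :=
  if (j %% 4 == r)%N then 2 * w 0%N else 0.

(* Lower bound for the total [excess] of the lots [1 .. j] minus the weights met so
   far, according to the last lots read.  The term [phase_drop] allows for the only
   prefix that pays nothing for its west border: it reads [.XX..XX..], with the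
   position in the pattern given by [j %% 4]. *)
Definition level (w : nat -> int) (x d s : nat -> bool) (j : nat) : int :=
  if triple x j || d j then 0
  else if x j then
    if x j.-1 then
      if triple x j.-1 && ~~ s j then w j else 2 + w j.+1 - phase_drop w 3 j
    else w j - (if x j.-2 || d j.-1 then 0 else phase_drop w 2 j)
  else if [&& x j.-1, x j.-2 & s j.-1] then w j - phase_drop w 0 j
  else w j.+1 - 2 - (if x j.-1 then 0 else phase_drop w 1 j).

(** * Excess of a single row *)

Section Row.
Variables (w : nat -> int) (n : nat) (x d s : nat -> bool).
Hypothesis w_ge0 : forall j, 0 <= w j.
Hypothesis w_le2 : forall j, w j + w j.+1 <= 2.
Hypothesis w_per : forall j, w j.+2 = w j.
Hypothesis x0 : x 0%N = false.
Hypothesis dx : forall j, d j -> ~~ x j.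
Hypothesis d1 : d 1%N = false.
Hypothesis just : forall j, (0 < j <= n)%N -> ~~ x j -> ~~ d j -> justified x s j.

Lemma weight_mod4 j : w j = w (j %% 4)%N.
Proof.
have w4 k r : w (k * 4 + r)%N = w r.
  by elim: k => [|k IHk] //; rewrite mulSn !addSn add0n !w_per.
by rewrite {1}(divn_eq j 4) w4.
Qed.

Lemma phase_drop_ge0 r j : 0 <= phase_drop w r j.
Proof. by rewrite /phase_drop; have := w_ge0 0; case: ifP => _; lia. Qed.

Lemma phase_drop_le r j : (r < 4)%N ->
  phase_drop w r j <= 2 * if odd r then w j.+1 else w j.
Proof.
move=> lt_r4; rewrite /phase_drop; case: eqP => [j4|_]; last first.
  by have := w_ge0 j; have := w_ge0 j.+1; case: ifP => _; lia.
have j4' : (j.+1 %% 4)%N = (r.+1 %% 4)%N by rewrite -j4 -addn1 -modnDml addn1.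
rewrite (weight_mod4 j) (weight_mod4 j.+1) j4' j4.
have := w_per 0; move: r lt_r4 {j4 j4'} => [|[|[|[|]]]] //= _;
  rewrite ?modnn ?modn_small //; lia.
Qed.

Lemma phase_dropS r j : phase_drop w r.+1 j.+1 = if (r < 3)%N then phase_drop w r j else 0.
Proof.
rewrite /phase_drop; have [lt_r3|le_3r] := ltnP r 3; last first.
  by case: eqP => //; lia.
by congr (if _ then _ else _); lia.
Qed.

Lemma phase_drop0S j : phase_drop w 0 j.+1 = phase_drop w 3 j.
Proof. by rewrite /phase_drop; congr (if _ then _ else _); lia. Qed.

Lemma level_step j : (0 < j < n)%N ->
  level w x d s j.+1 <=
    level w x d s j - side w d x j + side w (triple x) s j + excess x d j.+1.
Proof.
case: j => // k /= lt_k.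
have just1 : ~~ x k.+1 ==> ~~ d k.+1 ==> justified x s k.+1.
  by apply/implyP => nx; apply/implyP; apply: just nx; lia.
(* For [k = 0] the drop vanishes, as 1 is not 2 modulo 4; otherwise [just] applies to lot [k]. *)
have just0 : phase_drop w 2 k.+1 = 0 \/ [|| x k, d k | justified x s k].
  case: (posnP k) => [->|k_gt0]; [by left | right].
  case xk: (x k) => //=; case dk: (d k) => //=.
  by apply: just; rewrite ?xk ?dk //; lia.
have dx1 : d k.+1 ==> ~~ x k.+1 by apply/implyP/dx.
have dx2 : d k.+2 ==> ~~ x k.+2 by apply/implyP/dx.
rewrite /level /side /excess /triple !(phase_dropS _ k.+1) phase_drop0S !w_per /sgnb /=.
move: just1 just0 dx1 dx2; rewrite /justified /=.
have := w_ge0 k; have := w_ge0 k.+1; have := w_le2 k.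
have := phase_drop_ge0 0 k.+1; have := phase_drop_le k.+1 (isT : 0 < 4)%N.
have := phase_drop_ge0 1 k.+1; have := phase_drop_le k.+1 (isT : 1 < 4)%N.
have := phase_drop_ge0 2 k.+1; have := phase_drop_le k.+1 (isT : 2 < 4)%N.
have := phase_drop_ge0 3 k.+1; have := phase_drop_le k.+1 (isT : 3 < 4)%N.
rewrite /= !w_per.
move: (phase_drop w 0 k.+1) (phase_drop w 1 k.+1) (phase_drop w 2 k.+1) (phase_drop w 3 k.+1).
move: (x k.-2) (x k.-1) (x k) (x k.+1) (x k.+2) (x k.+3)
      (d k) (d k.+1) (d k.+2) (s k.-1) (s k) (s k.+1) (s k.+2).
move: (w k) (w k.+1) => v0 v1 x1 x2 x3 x4 x5 x6 d0 d2 d3 s0 s1 s2 s3 u0 u1 u2 u3.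
move=> ? ? ? ? ? ? ? ? ? ? ?.
case: d2 => /=.
  by case: x3; case: x4; case: x5; case: d3 => //= _ _ _ _; lia.
case: x4 => /=.
  move=> _; case: x5 => /= just0 _.
    case: d3 => //= _; case: x3 just0 => /= [_|just0].
      by case: x6; case: s3 => /=; lia.
    case: just0 => [u20|].
      by case: x6; case: s2; case: x2; case: d0 => /=; lia.
    by case: x6; case: s2; case: x2 => /=; case: d0 => //=; lia.
  case: x3 just0 => /= [_|just0] _; first by case: d3; case: x2; case: s2 => /=; lia.
  case: just0 => [u20|]; first by case: d3; case: x2; case: d0 => /=; lia.
  by case: d3; case: x2 => /=; case: d0 => //=; lia.
case: x3 => /=; case: x5 => //= just1 _ _.
- by clear just1; case: d3 => //=; case: x2; case: s1 => /=; lia.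
- move: just1; rewrite orbF => ->.
  by case: d3 => /= _; lia.
- by case: d3 => //=; lia.
Qed.

Lemma level_le j : (0 < j <= n)%N ->
  level w x d s j <= \sum_(1 <= i < j.+1) excess x d i - w 0%N
    - \sum_(1 <= p < j) side w d x p + \sum_(1 <= p < j) side w (triple x) s p.
Proof.
elim: j => // -[_ _|j IHj /andP[_ lt_j]].
  rewrite big_nat1 !big_geq // /level /excess /triple /phase_drop /= x0 d1 /=.
  have := w_ge0 0; have := w_le2 0; rewrite w_per.
  by rewrite if_same; case: (x 1); lia.
rewrite !(big_nat_recr j.+1) // (big_nat_recr j.+2) //=.
have := level_step (j := j.+1); have := IHj; rewrite ltnS leq0n (ltnW lt_j) lt_j.
move=> /(_ isT) + /(_ isT).
move: (level _ _ _ _ _) (level _ _ _ _ _) (\sum_(1 <= i < j.+2) _)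
  (\sum_(1 <= i < j.+1) _) (\sum_(1 <= i < j.+1) _); lia.
Qed.

Hypothesis n_gt0 : (0 < n)%N.
Hypothesis xn : x n.+1 = false.
Hypothesis dn : d n = false.
Hypothesis w_n : (n %% 4 == 0)%N -> w 0%N = 0.

Lemma row_excess_ge :
  w 0%N + w n + \sum_(1 <= p < n) side w d x p
    - \sum_(1 <= p < n) side w (triple x) s p
  <= \sum_(1 <= i < n.+1) excess x d i.
Proof.
suff: w n <= level w x d s n by have := level_le (j := n); rewrite n_gt0 leqnn => /(_ isT); lia.
rewrite /level /triple xn dn !andbF /=.
have := w_ge0 n; have := w_ge0 n.+1; have := w_le2 n => w2 wn1 wn.
case xn0: (x n); last first.
  have := just (j := n); rewrite n_gt0 leqnn xn0 dn /justified xn andbF => /(_ isT isT isT) /=.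
  rewrite orbF => ->; rewrite /phase_drop; case: eqP => [/eqP/w_n|_]; lia.
case xn1: (x n.-1).
  have := phase_drop_le n (isT : 3 < 4)%N => /= d3.
  by case: ifP; lia.
case: ifP => [|/norP[xn2 dn1]]; first lia.
rewrite /phase_drop; case: eqP => [n2|_]; last lia.
(* Lot [n.-1] is empty with no house at [n.-2] or [n.+1], so nothing justifies it. *)
have := just (j := n.-1).
rewrite xn1 dn1 /justified prednK // xn xn0 (negPf xn2) !andbF /=.
by move=> /(_ _ isT isT) F; have // := F _; lia.
Qed.
End Row.

(** * Summation over the rows *)

Section Grid.
Variables (w : nat -> int) (m n : nat) (c : nat -> nat -> bool).
Hypothesis w_ge0 : forall j, 0 <= w j.
Hypothesis w_le2 : forall j, w j + w j.+1 <= 2.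
Hypothesis w_per : forall j, w j.+2 = w j.
Hypothesis w_n : (n %% 4 == 0)%N -> w 0%N = 0.
Hypothesis n_ge2 : (2 <= n)%N.
Hypothesis c_in : forall i j, c i j -> (0 < i <= m)%N && (0 < j <= n)%N.
Hypothesis c_perm : forall i j, triple (c i) j -> ~~ c i.+1 j.
Hypothesis c_max : forall i j, (i < m)%N -> (0 < j <= n)%N ->
  ~~ c i.+1 j -> ~~ triple (c i) j -> justified (c i.+1) (c i.+2) j.

Let occ i : int := \sum_(1 <= j < n.+1) (c i j)%:Z.
Let centres i : int := \sum_(1 <= j < n.+1) (triple (c i) j)%:Z.
Let sides i : int := \sum_(1 <= p < n) side w (triple (c i)) (c i.+1) p.

Lemma c_out i j : ~~ ((0 < i <= m) && (0 < j <= n))%N -> c i j = false.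
Proof. by move=> out; apply/negP => /c_in; apply/negP. Qed.

Lemma triple_border i : triple (c i) 1 = false /\ triple (c i) n = false.
Proof.
by rewrite /triple (c_out (j := 0)) 1?(c_out (j := n.+1)) ?andbF //; lia.
Qed.

Lemma row_occ_ge i : (i < m)%N ->
  w 0%N + w n + (2 * centres i.+1 - sides i.+1) - (2 * centres i - sides i)
  <= 4 * occ i.+1 - 2 * n%:Z.
Proof.
move=> lt_im; have [t1 tn] := triple_border i.
have := @row_excess_ge w n (c i.+1) (triple (c i)) (c i.+2) w_ge0 w_le2 w_per.
rewrite !(@c_out i.+1) ?t1 ?tn; [|lia|lia].
move=> /(_ erefl (@c_perm i) erefl (fun j => @c_max i j lt_im)).
move=> /(_ (ltnW n_ge2) erefl erefl w_n).
(* Lots below centres are empty, so [excess x d] is [4 x - 2 - 2 triple x + 2 d] lot by lot. *)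
suff -> : \sum_(1 <= j < n.+1) excess (c i.+1) (triple (c i)) j =
    4 * occ i.+1 - 2 * n%:Z - 2 * centres i.+1 + 2 * centres i.
  by rewrite -/(sides i) -/(sides i.+1); lia.
have -> : n%:Z = \sum_(1 <= j < n.+1) 1.
  by rewrite big_const_nat subn1 iter_addr addr0 natz.
rewrite /occ /centres !mulr_sumr -!sumrB -big_split /=; apply: eq_bigr => j _.
have := @c_perm i j; rewrite /excess; case: (triple (c i) j) => [/(_ isT)|_].
  by rewrite /triple; case: (c i.+1 j); rewrite // andbF.
by rewrite /triple; case: (c i.+1 j); rewrite ?andbF //; case: (_ && _).
Qed.

(** Consecutive weights sum to at most 2, so the two ends of a block cost at most 2 per centre. *)
Lemma sides_le_centres i : sides i <= 2 * centres i.
Proof.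
have side_le p : side w (triple (c i)) (c i.+1) p <=
    w p * ((triple (c i) p)%:Z + (triple (c i) p.+1)%:Z).
  rewrite /side /sgnb ler_wpM2l //.
  by case: (triple _ p); case: (triple _ p.+1) => //=; case: ifP.
suff: forall k, (0 < k)%N ->
    \sum_(1 <= p < k) side w (triple (c i)) (c i.+1) p <=
    2 * \sum_(1 <= j < k) (triple (c i) j)%:Z + w k.+1 * (triple (c i) k)%:Z.
  have [_ tn] := triple_border i.
  move=> /(_ n (ltnW n_ge2)); rewrite /sides /centres big_nat_recr ?(ltnW n_ge2) //= tn.
  by rewrite mulr0 !addr0.
elim=> // -[_ _|k /(_ isT) IHk _].
  by rewrite !big_geq // mulr0 add0r mulr_ge0.
rewrite !(big_nat_recr k.+1) //= w_per.
have := side_le k.+1; have := w_le2 k.+1; move: IHk.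
move: (side _ _ _ _) (\sum_(1 <= p < k.+1) _) (\sum_(1 <= p < k.+1) _) => a b1 b2.
by rewrite w_per; case: (triple _ k.+1); case: (triple _ k.+2) => /=; lia.
Qed.

Lemma prefix_occ_ge k : (k <= m)%N ->
  k%:Z * (w 0%N + w n) <= \sum_(1 <= i < k.+1) (4 * occ i - 2 * n%:Z).
Proof.
move=> le_km; suff: k%:Z * (w 0%N + w n) + (2 * centres k - sides k) <=
    \sum_(1 <= i < k.+1) (4 * occ i - 2 * n%:Z).
  by have := sides_le_centres k; lia.
elim: k le_km => [|k IHk] lt_km.
  have t0 j : triple (c 0) j = false by rewrite /triple c_out.
  rewrite big_geq // mul0r /centres /sides !big1_seq ?mulr0 // => j _.
    by rewrite /side !t0 /= addr0 mulr0.
  by rewrite t0.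
have := IHk (ltnW lt_km); have := row_occ_ge lt_km.
rewrite (big_nat_recr k.+1) //=; move: (\sum_(_ <= _ < _) _) => S.
by rewrite -[in k.+1%:Z]addn1 PoszD mulrDl mul1r; lia.
Qed.

(** The first and last houses of a row are not centres; an empty border lot is justified only by the
    two lots next to it. *)
Lemma row_ends i : (i < m)%N -> exists a b,
  [/\ (0 < a < b)%N, (b <= n)%N, c i.+1 a && ~~ triple (c i.+1) a
    & c i.+1 b && ~~ triple (c i.+1) b].
Proof.
move=> lt_im; have [t1 tn] := triple_border i; have [u1 un] := triple_border i.+1.
have c0 : c i.+1 0 = false by apply: c_out; lia.
have cn : c i.+1 n.+1 = false by apply: c_out; lia.
have [a [a_gt0 ca a_lt]] : exists a, [/\ (0 < a)%N, c i.+1 a && ~~ triple (c i.+1) a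
    & a = 1%N \/ [/\ a = 2%N, c i.+1 1 = false & c i.+1 3]].
  case c1: (c i.+1 1); first by exists 1%N; rewrite c1 u1; split => //; left.
  have := @c_max i 1 lt_im (ltnW n_ge2); rewrite c1 t1 => /(_ isT isT).
  rewrite /justified /= c0 /= => /and3P[c2 c3 _]; exists 2%N.
  by rewrite /triple /= c1 c2; split=> //; right.
have [b [b_le cb b_gt]] : exists b, [/\ (b <= n)%N, c i.+1 b && ~~ triple (c i.+1) b
    & b = n \/ [/\ b = n.-1, c i.+1 n = false & c i.+1 n.-2]].
  case cn0: (c i.+1 n); first by exists n; rewrite cn0 un; split => //; left.
  have := @c_max i n lt_im; rewrite (ltnW n_ge2) leqnn cn0 tn => /(_ isT isT isT).
  rewrite /justified cn andbF /= orbF => /and3P[c2 c3 _]; exists n.-1.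
  rewrite /triple prednK ?(ltnW n_ge2) // cn0 c2 !andbF leq_pred.
  by split=> //; right.
exists a, b; split => //; rewrite a_gt0 /=.
case: a_lt b_gt => [->|[-> c1 c3]] [->|[-> cn0 cn2]] //.
- have : (0 < n.-2)%N by case/c_in/andP: cn2 => _ /andP[].
  by case: (n) => [|[|[]]].
- by case/c_in/andP: c3.
- have le3n : (3 <= n)%N by case/c_in/andP: c3.
  have : (3 < n)%N.
    by rewrite ltn_neqAle le3n andbT; apply/eqP => n3; rewrite -n3 c3 in cn0.
  by case: (n) => [|[]].
Qed.

Lemma occ_sub_centres_ge2 i : (i < m)%N -> 2 <= occ i.+1 - centres i.+1.
Proof.
move=> /row_ends[a [b [/andP[a_gt0 lt_ab] le_bn ca cb]]].
have one k : (0 < k <= n)%N -> \sum_(1 <= j < n.+1) (j == k)%:Z = 1.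
  move=> k_in; transitivity (\sum_(1 <= j < n.+1 | j == k) (1 : int)).
    by rewrite [RHS]big_mkcond; apply: eq_bigr => j _; case: (_ == _).
  by rewrite big_nat1_eq ltnS k_in.
have -> : 2 = \sum_(1 <= j < n.+1) ((j == a)%:Z + (j == b)%:Z).
  by rewrite big_split /= !one //; lia.
rewrite -sumrB; apply: ler_sum => j _.
have [->|_] := eqVneq j a.
  by rewrite (ltn_eqF lt_ab); case/andP: ca => -> /negPf->.
have [->|_] := eqVneq j b; first by case/andP: cb => -> /negPf->.
by rewrite /triple; case: (c i.+1 j); rewrite ?andbF //; case: (_ && _).
Qed.

(** With no row to the south nothing is [justified], so each empty lot lies below a centre. *)
Lemma last_row_occ i : m = i.+1 -> n%:Z - centres i <= occ m.
Proof.
move=> def_m; rewrite lerBlDl /occ /centres -big_split /=.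
have -> : n%:Z = \sum_(1 <= j < n.+1) 1.
  by rewrite big_const_nat subn1 iter_addr addr0 natz.
apply: ler_sum_nat => j j_in.
have := @c_max i j; rewrite def_m ltnSn j_in => /(_ isT isT).
case: (c i.+1 j) => /= [_|]; first by case: (triple _ _).
case: (triple _ _) => //= /(_ isT isT).
by rewrite /justified !(@c_out i.+2) ?andbF //; lia.
Qed.

(** The last two rows hold at least [n + 2] houses: the centres of row [k.+1] cancel. *)
Lemma grid_occ_ge k : m = k.+2 ->
  k%:Z * (w 0%N + w n) + 2 * (k.+2 * n)%N%:Z + 8 <=
  4 * \sum_(1 <= i < k.+3) occ i.
Proof.
move=> def_m.
have := prefix_occ_ge (_ : k <= m)%N; have := last_row_occ def_m.
have := @occ_sub_centres_ge2 k; rewrite def_m => /(_ _) h1 h2 /(_ _) h3.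
have {}h1 := h1 ltac:(lia); have {}h3 := h3 ltac:(lia).
have sum_n : \sum_(1 <= i < k.+1) 2 * n%:Z = 2 * n%:Z * k%:Z.
  by rewrite big_const_nat subSS subn0 iter_addr addr0 -[LHS]mulr_natr (natz k).
rewrite (big_nat_recr k.+2) // (big_nat_recr k.+1) //=.
move: h1 h2 h3; rewrite sumrB -mulr_sumr sum_n.
move: (occ _) (occ _) (centres _) (\sum_(_ <= _ < _) _) (w 0%N) (w n) => a b t S u v.
by clear; nia.
Qed.
End Grid.

(* Configurations as Boolean rows *)
Local Close Scope ring_scope.

Definition occupied (m n : nat) (C : config m n) (i j : nat) : bool :=
  [exists z in C, (z.1.+1 == i) && (z.2.+1 == j)].

Section Config.
Variables (m n : nat).
Implicit Types (C : config m n) (z : 'I_m * 'I_n).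

Lemma occupied_lot C z : occupied C z.1.+1 z.2.+1 = (z \in C).
Proof.
apply/exists_inP/idP => [[y yC]|zC]; last by exists z; rewrite ?eqxx.
by rewrite !eqSS => /andP[/eqP/val_inj y1 /eqP/val_inj y2]; case: z y y1 y2 yC => a b [/= ? ? -> ->].
Qed.

Lemma occupiedP C i j :
  reflect (exists2 z, z \in C & i = z.1.+1 /\ j = z.2.+1) (occupied C i j).
Proof.
apply: (iffP exists_inP) => [[z zC /andP[/eqP <- /eqP <-]]|[z zC [-> ->]]].
  by exists z.
by exists z; rewrite ?eqxx.
Qed.

Lemma occupiedU1 C z i j : occupied (z |: C) i j =
  ((i == z.1.+1) && (j == z.2.+1)) || occupied C i j.
Proof.
apply/occupiedP/orP => [[y /setU1P[-> [-> ->]|yC [-> ->]]]|].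
- by left; rewrite !eqxx.
- by right; rewrite occupied_lot.
case=> [/andP[/eqP-> /eqP->]|/occupiedP[y yC [-> ->]]].
  by exists z; rewrite ?setU11.
by exists y; rewrite // setU1r.
Qed.

Lemma blockedE C z : blocked C z =
  triple (occupied C z.1.+1) z.2.+1 && occupied C z.1.+2 z.2.+1.
Proof.
rewrite /blocked /triple /= occupied_lot.
have -> : [exists e in C, (e.1 == z.1) && (e.2 == z.2.+1 :> nat)] = occupied C z.1.+1 z.2.+2.
  by apply: eq_existsb => e; rewrite !eqSS.
have -> : [exists y in C, (y.1 == z.1) && (y.2.+1 == z.2 :> nat)] = occupied C z.1.+1 z.2.
  by apply: eq_existsb => e; rewrite !eqSS.
have -> : [exists y in C, (y.1 == z.1.+1 :> nat) && (y.2 == z.2)] = occupied C z.1.+2 z.2.+1.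
  by apply: eq_existsb => e; rewrite !eqSS.
by case: (z \in C); case: (occupied C _ z.2); rewrite ?andbF.
Qed.

Lemma occupied_in C i j : occupied C i j -> (0 < i <= m) && (0 < j <= n).
Proof. by case/occupiedP => z _ [-> ->]; rewrite !ltn_ord. Qed.

Lemma occupied_perm C i j : permissible C ->
  triple (occupied C i) j -> ~~ occupied C i.+1 j.
Proof.
move=> /forall_inP permC t; case/and3P: (t) => _ /occupiedP[z zC [def_i def_j]] _.
by have := permC z zC; rewrite blockedE -def_i -def_j t.
Qed.

Lemma occupied_max C i j : maximal C -> i < m -> 0 < j <= n ->
  ~~ occupied C i.+1 j -> ~~ triple (occupied C i) j ->
  justified (occupied C i.+1) (occupied C i.+2) j.
Proof.
move=> /maxsetP[permC maxC] lt_im; case: j => // j lt_jn Nij Ntr.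
pose z := (Ordinal lt_im, Ordinal lt_jn).
have zC : z \notin C by rewrite -occupied_lot.
have : ~~ permissible (z |: C).
  apply: contra zC => permU; rewrite -(maxC _ permU) ?setU11 //.
  by apply/subsetP => y yC; rewrite setU1r.
case/forall_inPn => -[a b] abU; rewrite negbK blockedE.
have : ~~ blocked C (a, b).
  have [abC|abC] := boolP ((a, b) \in C); last by rewrite /blocked (negPf abC).
  by move/forall_inP: permC => /(_ _ abC).
rewrite blockedE /triple !occupiedU1 /=; case: a b {abU} => a _ [b _] /= Nbl.
rewrite /justified /=; rewrite /triple /= in Ntr.
(* In another row, the new house can only obstruct from the south, which would put it below a
   centre. *)
have [ai|ai] := eqVneq a.+1 i.+1; last first.
  case/andP=> /and3P[/= cw ch ce] /orP[/andP[/eqP ai1 /eqP bj]|cs].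
    by move: Ntr; case: ai1 bj => <- [<-]; rewrite cw ch ce.
  by rewrite cw ch ce cs in Nbl.
rewrite ai in Nbl *.
have -> : (i.+2 == i.+1) = false by rewrite eqSS gtn_eqF.
rewrite /=.
have [->|_] := eqVneq b j.+1.
  by rewrite !gtn_eqF //= => /andP[/andP[-> ->] ->]; rewrite !orbT.
rewrite eqSS; have [->|_] := eqVneq b j.
  by rewrite gtn_eqF //= => /andP[/andP[-> ->] ->].
rewrite eqSS; have [<-|_] := eqVneq b.+1 j.
  by move=> /= /andP[/and3P[-> -> _] ->]; rewrite orbT.
by rewrite /= (negPf Nbl).
Qed.

Lemma card_occupied C :
  #|C| = \sum_(1 <= i < m.+1) \sum_(1 <= j < n.+1) occupied C i j.
Proof.
rewrite big_add1 big_mkord; under eq_bigr => i _ do rewrite big_add1 big_mkord.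
rewrite pair_bigA /= -sum1_card big_mkcond; apply: eq_bigr => z _ /=.
by rewrite occupied_lot; case: (z \in C).
Qed.
End Config.

(* [u] and [v] are the weights at even and odd positions. *)
Lemma maximal_card_ge (u v : nat) (m n : nat) (C : config m n) :
    u + v <= 2 -> (n %% 4 == 0 -> u = 0) -> 2 <= m -> 2 <= n -> maximal C ->
  (m - 2) * (u + if odd n then v else u) + 2 * (m * n) + 8 <= 4 * #|C|.
Proof.
move=> uv2 u0 m_ge2 n_ge2 maxC.
pose w j : int := if odd j then v else u.
have w_ge0 j : (0 <= w j)%R by rewrite /w; case: ifP.
have w_le2 j : (w j + w j.+1 <= 2)%R by rewrite /w /=; case: (odd j) => /=; lia.
have w_per j : w j.+2 = w j by rewrite /w /= negbK.
have w_n : n %% 4 == 0 -> w 0 = 0%R by rewrite /w /= => /u0->.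
have def_m : m = (m - 2).+2 by lia.
have /maxsetP[permC _] := maxC.
have := @grid_occ_ge w m n (occupied C) w_ge0 w_le2 w_per w_n n_ge2
  (@occupied_in m n C) (fun i j => @occupied_perm m n C i j permC)
  (fun i j => @occupied_max m n C i j maxC) (m - 2) def_m.
rewrite -def_m card_occupied.
have -> : (\sum_(1 <= i < m.+1) \sum_(1 <= j < n.+1) (occupied C i j)%:Z)%R
    = Posz (\sum_(1 <= i < m.+1) \sum_(1 <= j < n.+1) occupied C i j).
  rewrite (big_morph Posz PoszD (erefl _)); apply: eq_bigr => i _.
  by rewrite (big_morph Posz PoszD (erefl _)).
by rewrite /w /=; case: (odd n); move: (\sum_(_ <= _ < _) _) => S; lia.
Qed.

Theorem theorem4p5 (m n : nat) (hm : 2 <= m) (hn : 2 <= n)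
    (C : config m n) (hC : maximal C) :
  min_occupancy m n <= #|C| /\
  [/\ (n = 0 %[mod 4] -> (m * n) %/ 2 + 2 <= min_occupancy m n),
      (n = 2 %[mod 4] -> (m * (n + 2)) %/ 2 <= min_occupancy m n) &
      (n = 1 %[mod 2] -> (m * (n + 1)) %/ 2 + 1 <= min_occupancy m n)].
Proof.
rewrite /min_occupancy; case: ex_minnP => k /existsP[C0 /andP[maxC0 /eqP <-]] min_k.
split; first by apply: min_k; apply/existsP; exists C; rewrite hC /=.
have bound u v uv2 u0 := @maximal_card_ge u v m n C0 uv2 u0 hm hn maxC0.
have def_m : m = m - 2 + 2 by lia.
split=> n_mod.
- by have := bound 0 0 isT (fun=> erefl); rewrite if_same; lia.
- have n_even : odd n = false by lia.
  (* [4 (m - 2) + 2 m n + 8 = 2 m (n + 2)]. *)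
  have := bound 2 0 isT ltac:(lia); rewrite n_even; nia.
- have n_odd : odd n by lia.
  (* [2 (m - 2) + 2 m n + 8 = 2 m (n + 1) + 4]. *)
  have := bound 1 1 isT ltac:(lia); rewrite n_odd; nia.
Qed.
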